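(* Let $k\ge 0$ and $n\ge 0$ be integers, and let $U_1,U_2,\ldots,U_k$ be independent random variables, each uniformly distributed on $(0,1)$. Then \[ \sum_{m=0}^n \sum_{l=k}^{m+k} \frac{\binom{n}{m}}{\binom{m+k}{m}}\, S_2(l,k)\, S_2(m+k,l)\, B_{n-m}^{(k)} \;=\; \sum_{m=0}^n S_2(n,m)\, E\big[(U_1+\cdots+U_k)^m\big]. \]
   Context: $S_2(n,l)$ denotes the Stirling numbers of the second kind, defined by $x^n=\sum_{l=0}^n S_2(n,l)(x)_l$, where $(x)_0=1$ and $(x)_l=x(x-1)\cdots(x-l+1)$. The Bernoulli numbers of order $k$, $B_j^{(k)}$, are defined by $\left(\frac{t}{e^t-1}\right)^k=\sum_{j=0}^\infty B_j^{(k)}\frac{t^j}{j!}$. $E$ denotes expectation. *)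

(* Defs.v *)
From HB Require Import structures.
From mathcomp Require Import all_boot all_order all_algebra.
From mathcomp Require Import all_classical all_reals all_analysis.
From mathcomp Require Import ring.

Set Implicit Arguments.
Unset Strict Implicit.
Unset Printing Implicit Defensive.
Import Order.TTheory GRing.Theory Num.Theory.
Import numFieldNormedType.Exports.
Local Open Scope classical_set_scope.
Local Open Scope ring_scope.

Definition falling_factorial (R : realType) (x : R) (l : nat) : R :=
  \prod_(i < l) (x - i%:R).

(* [s] is the sequence l |-> S_2(n, l), extended by 0 for l > n; the equation
   determines s on 0 .. n (see [stirling2_unique]). *)
Definition is_stirling2_row (R : realType) (n : nat) (s : nat -> R) : Prop :=
  (forall x : R, x ^+ n = \sum_(l < n.+1) s l * falling_factorial x l) /\
  (forall l : nat, (n < l)%N -> s l = 0).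

Lemma stirling2_exists (R : realType) (n : nat) :
  exists s : nat -> R, is_stirling2_row n s.
Proof.
elim: n => [|n [s [sE s0]]].
  exists (fun l => (l == 0%N)%:R); split=> [x|[]//].
  by rewrite big_ord1 /falling_factorial big_ord0 expr0 mulr1.
exists (fun l => l%:R * s l + (if l is l'.+1 then s l' else 0)); split; last first.
  by case=> // l nl; rewrite !s0 ?mulr0 ?addr0 // ltnW.
move=> x; rewrite exprSr sE mulr_suml.
under [RHS]eq_bigr do rewrite mulrDl.
rewrite big_split /= [X in _ = X + _]big_ord_recr /= s0 // mulr0 mul0r addr0.
rewrite [X in _ + X]big_ord_recl /= mul0r add0r -big_split /=.
apply: eq_bigr => l _; rewrite /bump /= add1n /falling_factorial big_ord_recr /=.
ring.
Qed.

Definition stirling2 (R : realType) (n : nat) : nat -> R :=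
  projT1 (cid (stirling2_exists R n)).

Lemma stirling2P (R : realType) (n : nat) : is_stirling2_row n (stirling2 R n).
Proof. exact: projT2 (cid (stirling2_exists R n)). Qed.

Lemma stirling2_unique (R : realType) (n : nat) (s : nat -> R) :
  is_stirling2_row n s -> s = stirling2 R n.
Proof.
move=> [sE s0]; have [tE t0] := stirling2P R n.
apply/funext => m; elim/ltn_ind: m => m IH.
have [mn|nm] := leqP m n; last by rewrite s0 ?t0.
have := etrans (esym (sE m%:R)) (tE m%:R).
rewrite (bigD1 (Ordinal (mn : (m < n.+1)%N))) //=.
rewrite [X in _ = X -> _](bigD1 (Ordinal (mn : (m < n.+1)%N))) //=.
have -> : \sum_(i < n.+1 | i != Ordinal (mn : (m < n.+1)%N))
      s i * falling_factorial m%:R i =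
    \sum_(i < n.+1 | i != Ordinal (mn : (m < n.+1)%N))
      stirling2 R n i * falling_factorial m%:R i.
  apply: eq_bigr => i im.
  have [/IH-> //|mi] := ltnP i m.
  have mi' : (m < i)%N by rewrite ltn_neqAle mi andbT eq_sym.
  by rewrite /falling_factorial (bigD1 (Ordinal mi')) //= subrr mul0r !mulr0.
move/addIr/mulIf; apply; apply/prodf_neq0 => i _.
by rewrite subr_eq0 eqr_nat gtn_eqF.
Qed.

(* A formal power series \sum_n a_n t^n is represented by its sequence of
   coefficients [a : nat -> R]. *)
Definition fps_one (R : realType) : nat -> R := fun n => (n == 0%N)%:R.

Definition fps_t (R : realType) : nat -> R := fun n => (n == 1%N)%:R.

Definition fps_expm1 (R : realType) : nat -> R :=
  fun n => if n == 0%N then 0 else (n`!)%:R^-1.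

Definition fps_mul (R : realType) (a b : nat -> R) : nat -> R :=
  fun n => \sum_(i < n.+1) a i * b (n - i)%N.

Definition fps_pow (R : realType) (a : nat -> R) (k : nat) : nat -> R :=
  iter k (fps_mul a) (@fps_one R).

Lemma fps_quotient_exists (R : realType) :
  exists g : nat -> R, fps_mul g (@fps_expm1 R) = @fps_t R.
Proof.
pose F n (h : nat -> R) : R :=
  (n == 0%N)%:R - \sum_(i < n) h i * fps_expm1 R (n.+1 - i)%N.
pose pre := fix pre n : seq R :=
  if n is m.+1 then rcons (pre m) (F m (nth 0 (pre m))) else [::].
have size_pre n : size (pre n) = n by elim: n => //= n IH; rewrite size_rcons IH.
have nth_pre n i : (i < n)%N -> nth 0 (pre n) i = nth 0 (pre i.+1) i.
  elim: n => // n IH; rewrite ltnS leq_eqVlt => /predU1P[-> //|lt_in].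
  by rewrite -IH // [pre n.+1]/= nth_rcons size_pre lt_in.
exists (fun i => nth 0 (pre i.+1) i); apply/funext => -[|n].
  by rewrite /fps_mul big_ord1 subnn /fps_expm1 /= mulr0.
rewrite /fps_mul !big_ord_recr /= subnn [fps_expm1 R 0]/fps_expm1 eqxx mulr0 addr0.
rewrite subSnn [fps_expm1 R 1]/fps_expm1 /= invr1 mulr1 nth_rcons size_pre.
rewrite ltnn eqxx /F /fps_t eqSS addrC -[RHS]addr0 -addrA; congr (_ + _).
apply/eqP; rewrite addrC subr_eq0; apply/eqP; apply: eq_bigr => i _.
by rewrite (nth_pre n i).
Qed.

(* The formal power series t / (e^t - 1), i.e. the unique g with
   g * (e^t - 1) = t. *)
Definition fps_t_div_expm1 (R : realType) : nat -> R :=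
  projT1 (cid (fps_quotient_exists R)).

Lemma fps_t_div_expm1P (R : realType) :
  fps_mul (fps_t_div_expm1 R) (@fps_expm1 R) = @fps_t R.
Proof. exact: projT2 (cid (fps_quotient_exists R)). Qed.

Lemma fps_t_div_expm1_unique (R : realType) (g : nat -> R) :
  fps_mul g (@fps_expm1 R) = @fps_t R -> g = fps_t_div_expm1 R.
Proof.
move=> gE; have := fps_t_div_expm1P R; rewrite -gE => E.
apply/funext => n; elim/ltn_ind: n => n IH.
have := congr1 (@^~ n.+1) E; rewrite /fps_mul !big_ord_recr /= subnn subSnn.
rewrite [fps_expm1 R 0]/fps_expm1 [fps_expm1 R 1]/fps_expm1 /= invr1 !mulr1.
rewrite !mulr0 !addr0; under eq_bigr => i _ do rewrite -IH //.
by move/addrI.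
Qed.

(* B_j^{(k)}: j! times the coefficient of t^j in (t / (e^t - 1))^k. *)
Definition bernoulli_order (R : realType) (k j : nat) : R :=
  (j`!)%:R * fps_pow (fps_t_div_expm1 R) k j.

Definition independent_RVs (d : measure_display) (T : measurableType d)
    (R : realType) (P : probability T R) (I : finType)
    (X : I -> {RV P >-> R}) : Prop :=
  forall (J : {set I}) (A : I -> set R),
    (forall i, i \in J -> measurable (A i)) ->
    P (\bigcap_(i in [set j | j \in J]) (X i @^-1` A i)) =
    (\prod_(i in J) P (X i @^-1` A i))%E.

(* [uniform_prob] is supported on `[0, 1]; the endpoints are null, so this is
   also the uniform law on (0, 1). *)
Definition uniform01 (d : measure_display) (T : measurableType d)
    (R : realType) (P : probability T R) (X : {RV P >-> R}) : Prop :=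
  forall A : set R, measurable A ->
    distribution P X A = uniform_prob (@ltr01 R) A.

(* Main.v *)
(* With u = e^t - 1 and phi = u / t, the identity
   S_2(n, l) = n!/l! [t^n] u^l turns the left-hand side into n! times
   \sum_j [t^j] phi^k * [t^(n+k)] (u^(j+k) (t/u)^k)
     = \sum_j [t^j] phi^k * [t^n] u^j,
   while independence gives E[(U_1 + ... + U_k)^j] = j! [t^j] phi^k, because
   E[U_i^a] = 1/(a+1) = a! [t^a] phi. *)
From HB Require Import structures.
Require Import Defs.
From mathcomp Require Import all_boot all_order all_algebra.
From mathcomp Require Import all_classical all_reals all_analysis.
From mathcomp Require Import measurable_realfun ring.
Set Implicit Arguments.
Unset Strict Implicit.
Unset Printing Implicit Defensive.
Import Order.TTheory GRing.Theory Num.Theory.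
Import numFieldNormedType.Exports.
Local Open Scope ring_scope.

(** * Arithmetic of formal power series *)

Section formal_power_series.
Context {R : realType}.
Implicit Types a b c : nat -> R.

(** The coefficient of t^n only involves coefficients of index at most n, so truncation is harmless;
    the ring laws and the Leibniz rule are transferred from polynomials this way. *)
Lemma fps_mul_poly a b N n : (n < N)%N ->
  fps_mul a b n = ((\poly_(i < N) a i) * (\poly_(i < N) b i))`_n.
Proof.
move=> nN; rewrite coefM; apply: eq_bigr => i _; rewrite !coef_poly.
by rewrite (leq_ltn_trans (leq_subr i n) nN) (leq_ltn_trans (leq_ord i) nN).
Qed.

Lemma fps_mulC a b : fps_mul a b = fps_mul b a.
Proof. by apply/funext => n; rewrite !(fps_mul_poly _ _ (ltnSn n)) mulrC. Qed.

Lemma fps_mulA a b c : fps_mul a (fps_mul b c) = fps_mul (fps_mul a b) c.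
Proof.
apply/funext => n; pose Q (x : nat -> R) := \poly_(i < n.+1) x i.
have abc x y z : fps_mul (fps_mul x y) z n = (Q x * Q y * Q z)`_n.
  rewrite coefM; apply: eq_bigr => i _.
  rewrite (fps_mul_poly _ _ (ltn_ord i)) coef_poly.
  by rewrite ltnS leq_subr.
(* [abc] covers left-nested products only, so a(bc) is first turned into (bc)a. *)
by rewrite fps_mulC !abc mulrC mulrA.
Qed.

Lemma fps_mulCA a b c : fps_mul a (fps_mul b c) = fps_mul b (fps_mul a c).
Proof. by rewrite !fps_mulA (fps_mulC a). Qed.

Lemma fps_mul1l a : fps_mul (@fps_one R) a = a.
Proof.
apply/funext => n; rewrite /fps_mul big_ord_recl /fps_one /= mul1r subn0.
by rewrite big1 ?addr0// => i _; rewrite mul0r.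
Qed.

Lemma fps_powD a j k :
  fps_pow a (j + k) = fps_mul (fps_pow a j) (fps_pow a k).
Proof.
elim: j => [|j IH]; first by rewrite fps_mul1l.
by rewrite addSn /fps_pow !iterS -!/(fps_pow _ _) IH fps_mulA.
Qed.

Lemma fps_powM a b k :
  fps_pow (fps_mul a b) k = fps_mul (fps_pow a k) (fps_pow b k).
Proof.
elim: k => [|k IH]; first by rewrite fps_mul1l.
rewrite /fps_pow !iterS -!/(fps_pow _ _) IH -!fps_mulA; congr fps_mul.
by rewrite fps_mulCA.
Qed.

Lemma fps_pow_one k : fps_pow (@fps_one R) k = @fps_one R.
Proof. by elim: k => // k IH; rewrite /fps_pow iterS -/(fps_pow _ _) IH fps_mul1l. Qed.

Lemma fps_mul_t a n : fps_mul (@fps_t R) a n = if n is n'.+1 then a n' else 0.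
Proof.
case: n => [|n]; first by rewrite /fps_mul big_ord1 mul0r.
rewrite /fps_mul 2!big_ord_recl /fps_t /= mul0r add0r mul1r subSS subn0.
by rewrite big1 ?addr0// => i _; rewrite mul0r.
Qed.

Lemma fps_mul_pow_t a k n :
  fps_mul (fps_pow (@fps_t R) k) a n = if (n < k)%N then 0 else a (n - k)%N.
Proof.
elim: k n => [|k IH] n; first by rewrite fps_mul1l subn0.
rewrite /fps_pow iterS -/(fps_pow _ _) -fps_mulA fps_mul_t.
by case: n => // n; rewrite IH ltnS subSS.
Qed.

(** Leibniz rule: [i.+1%:R * a i.+1] is the coefficient of t^i in the derivative of [a]. *)
Lemma fps_derivM a b n :
  n.+1%:R * fps_mul a b n.+1 =
  fps_mul (fun i => i.+1%:R * a i.+1) b n +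
  fps_mul a (fun i => i.+1%:R * b i.+1) n.
Proof.
rewrite (fps_mul_poly _ _ (ltnSn n.+1)).
rewrite mulr_natl -coef_deriv derivM coefD !coefM.
have lt_n (m : nat) : (m <= n)%N -> ((m < n.+2)%N * (m.+1 < n.+2)%N)%type.
  by move=> mn; rewrite !ltnS mn (leq_trans mn).
congr (_ + _); apply: eq_bigr => i _; have ni := leq_subr i n;
  have li : (i <= n)%N := leq_ord i.
  by rewrite coef_deriv !coef_poly (lt_n _ ni) (lt_n _ li) mulr_natl.
by rewrite coef_deriv !coef_poly (lt_n _ ni) (lt_n _ li) mulr_natl.
Qed.

(** * Powers of u = e^t - 1 and phi = u / t, and their link to Stirling numbers *)

Definition fps_expm1_div_t : nat -> R := fun n => (n.+1`!)%:R^-1.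

Local Notation u := (@fps_expm1 R).
Local Notation phi := fps_expm1_div_t.

Lemma fps_expm1E : u = fps_mul (@fps_t R) phi.
Proof. by apply/funext => n; rewrite fps_mul_t; case: n. Qed.

(** Since u = t phi, u^(j+k) = t^k phi^k u^j, and the factor t^k shifts indices by k. *)
Lemma fps_pow_expm1D j k m :
  fps_pow u (j + k) (m + k) = fps_mul (fps_pow phi k) (fps_pow u j) m.
Proof.
rewrite fps_powD fps_mulC [in fps_pow u k]fps_expm1E fps_powM -fps_mulA.
by rewrite fps_mul_pow_t ltnNge leq_addl addnK.
Qed.

Lemma fps_pow_expm1_eq0 l n : (n < l)%N -> fps_pow u l n = 0.
Proof. by rewrite fps_expm1E fps_powM fps_mul_pow_t => ->. Qed.

(** Substituting u = t phi in (t/u) u = t and comparing coefficients of t^(n+1) cancels one factor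
    t. *)
Lemma fps_expm1_div_tK : fps_mul phi (fps_t_div_expm1 R) = @fps_one R.
Proof.
apply/funext => n.
have /(congr1 (@^~ n.+1)) := fps_t_div_expm1P R.
rewrite fps_mulC fps_expm1E -fps_mulA fps_mul_t => ->.
by rewrite /fps_t /fps_one eqSS.
Qed.

(** Since u' = u + 1, (u^l)' = l u^(l-1) u' = l (u^l + u^(l-1)); for l = 0 both sides vanish. *)
Lemma fps_deriv_pow_expm1 l n :
  n.+1%:R * fps_pow u l n.+1 = l%:R * (fps_pow u l n + fps_pow u l.-1 n).
Proof.
elim: l n => [|l IH] n; first by rewrite mul0r mulr0.
have -> : fps_pow u l.+1 = fps_mul u (fps_pow u l) by [].
rewrite fps_derivM (_ : (fun i => i.+1%:R * u i.+1) =
    (fun i => u i + @fps_one R i)); last first.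
  apply/funext => i; rewrite /fps_expm1 /fps_one /= factS natrM invfM mulVKf ?pnatr_eq0//.
  by case: i => [|i] /=; rewrite ?invr1 ?add0r ?addr0.
under [X in _ + fps_mul _ X _]eq_fun do rewrite IH.
have -> : fps_mul (fun i => u i + @fps_one R i) (fps_pow u l) n =
    fps_mul u (fps_pow u l) n + fps_pow u l n.
  rewrite -[X in _ = _ + X n](fps_mul1l (fps_pow u l)) -big_split /=; apply: eq_bigr => i _.
  by rewrite mulrDl.
have -> : fps_mul u (fun i => l%:R * (fps_pow u l i + fps_pow u l.-1 i)) n =
    l%:R * (fps_mul u (fps_pow u l) n + fps_mul u (fps_pow u l.-1) n).
  by rewrite -big_split mulr_sumr /=; apply: eq_bigr => i _; ring.
case: l {IH} => [|l]; first by rewrite mul0r addr0 mul1r.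
rewrite -[l.+1.-1]/l -[fps_mul u (fps_pow u l) n]/(fps_pow u l.+1 n).
by rewrite -[l.+2%:R]natr1; ring.
Qed.

(** As x (x)_l = (x)_(l+1) + l (x)_l, the right-hand side satisfies the defining equation of row
    n+1, and rows are unique. *)
Lemma stirling2S n l :
  stirling2 R n.+1 l =
  l%:R * stirling2 R n l + (if l is l'.+1 then stirling2 R n l' else 0).
Proof.
have [sE s0] := stirling2P R n.
suff <- : (fun l => l%:R * stirling2 R n l +
  (if l is l'.+1 then stirling2 R n l' else 0)) = stirling2 R n.+1 by [].
apply: stirling2_unique; split; last first.
  by case=> // l' nl; rewrite !s0 ?mulr0 ?addr0 // ltnW.
move=> x; rewrite exprSr sE mulr_suml.
under [RHS]eq_bigr do rewrite mulrDl.
rewrite big_split /= [X in _ = X + _]big_ord_recr /= s0 // mulr0 mul0r addr0.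
rewrite [X in _ + X]big_ord_recl /= mul0r add0r -big_split /=.
apply: eq_bigr => i _; rewrite /bump /= add1n /Defs.falling_factorial big_ord_recr /=.
ring.
Qed.

(** By the formula for (u^l)', the right-hand side obeys the recurrence [stirling2S]. *)
Lemma stirling2_fps n l :
  stirling2 R n l = n`!%:R / l`!%:R * fps_pow u l n.
Proof.
elim: n l => [|n IH] l.
  have [s1 s0] := stirling2P R 0.
  case: l => [|l]; last by rewrite s0// fps_pow_expm1_eq0// mulr0.
  have := s1 0; rewrite expr0 big_ord1 /Defs.falling_factorial big_ord0 mulr1 => <-.
  by rewrite divr1 mulr1.
have f0 m : m`!%:R != 0 :> R by rewrite pnatr_eq0 -lt0n fact_gt0.
have -> : n.+1`!%:R / l`!%:R * fps_pow u l n.+1 =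
    n`!%:R / l`!%:R * (l%:R * (fps_pow u l n + fps_pow u l.-1 n)).
  by rewrite -fps_deriv_pow_expm1 factS natrM; ring.
rewrite stirling2S IH.
case: l => [|l]; first by rewrite !mul0r !mulr0 addr0.
by rewrite IH /= factS natrM; field; rewrite f0 nat1r pnatr_eq0.
Qed.

(** The combinatorial half of the theorem: m! [t^m] phi^k stands for the m-th moment of the sum. *)
Lemma sum_stirling2_bernoulli k n :
  \sum_(m < n.+1) \sum_(k <= l < (m + k).+1)
      ('C(n, m))%:R / ('C(m + k, m))%:R
      * stirling2 R l k * stirling2 R (m + k) l
      * bernoulli_order R k (n - m)
  = \sum_(m < n.+1) stirling2 R n m * (m`!%:R * fps_pow phi k m).
Proof.
have f0 m : m`!%:R != 0 :> R by rewrite pnatr_eq0 -lt0n fact_gt0.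
set g := fps_pow (fps_t_div_expm1 R) k.
have E (m : 'I_n.+1) : \sum_(k <= l < (m + k).+1)
      ('C(n, m))%:R / ('C(m + k, m))%:R
      * stirling2 R l k * stirling2 R (m + k) l
      * bernoulli_order R k (n - m) =
    \sum_(j < n.+1) n`!%:R * fps_pow phi k j *
      (fps_mul (fps_pow phi k) (fps_pow u j) m * g (n - m)%N).
  (* Substitute l = j + k, then let j run up to n so that the two sums can be exchanged; the added
     terms, with m < j, vanish because t^j divides u^j. *)
  rewrite -{1}[k]add0n big_addn subSn ?leq_addl// addnK.
  have mn := ltn_ord m; rewrite ltnS in mn.
  rewrite (big_nat_widen 0 m.+1 n.+1)// big_mkcond /= big_mkord.
  apply: eq_bigr => j _; case: ifPn => [_|]; last first.
    rewrite -leqNgt => mj; rewrite -fps_pow_expm1D fps_pow_expm1_eq0 ?mul0r ?mulr0//.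
    by rewrite ltn_add2r.
  rewrite !stirling2_fps /bernoulli_order -/g -fps_pow_expm1D.
  have -> : fps_pow u k (j + k) = fps_pow phi k j.
    rewrite -[in fps_pow u k](add0n k) fps_pow_expm1D fps_mulC.
    by rewrite [fps_pow u 0]/(@fps_one R) fps_mul1l.
  (* Writing both binomials through factorials, everything cancels except n!. *)
  have := congr1 (fun x => x%:R : R) (bin_fact mn); rewrite !natrM => <-.
  have := congr1 (fun x => x%:R : R) (bin_fact (leq_addr k m)); rewrite !natrM addKn => <-.
  have B0 : ('C(m + k, m))%:R != 0 :> R by rewrite pnatr_eq0 -lt0n bin_gt0 leq_addr.
  by field; rewrite !f0 B0.
under eq_bigr do rewrite E.
rewrite exchange_big /=; apply: eq_bigr => j _.
(* The sum over m is a Cauchy product: the coefficient of t^n in phi^k u^j (t/u)^k = u^j. *)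
rewrite -mulr_sumr -/(fps_mul (fps_mul (fps_pow phi k) (fps_pow u j)) g n).
rewrite (fps_mulC (fps_pow phi k)) -fps_mulA -fps_powM fps_expm1_div_tK.
rewrite fps_pow_one fps_mulC fps_mul1l stirling2_fps.
by field; rewrite f0.
Qed.

End formal_power_series.

(** * Weighted integrals of functions of a random variable *)

Section ge0_integral_comp.
Local Open Scope classical_set_scope.
Context d (T : measurableType d) (R : realType) (mu : {measure set T -> \bar R}).
Variables (X : T -> R) (mX : measurable_fun setT X).
Import HBNNSimple.

(** Monotone convergence along simple functions increasing to [f]: the weight [W] enters the limit
    only through its integrals against indicators of events of [X]. *)
Lemma ge0_integralM_comp_lim (W : T -> R) (f : R -> R)
    (mf : measurable_fun [set: R] (fun x => (f x)%:E)) :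
  measurable_fun setT W -> (forall w, 0 <= W w) -> (forall x, 0 <= f x) ->
  (\int[mu]_w (W w * f (X w))%:E =
   limn (fun n => \sum_(y \in range (nnsfun_approx measurableT mf n))
     y%:E * \int[mu]_w
       (W w * \1_(nnsfun_approx measurableT mf n @^-1` [set y]) (X w))%:E))%E.
Proof.
move=> mW W0 f0; set h := nnsfun_approx measurableT mf.
have mhX (g : {mfun R >-> R}) : measurable_fun setT (fun w => W w * g (X w)).
  apply: measurable_funM => //.
  by apply: (@measurableT_comp _ _ _ _ _ _ g _ X) => //.
transitivity (limn (fun n => \int[mu]_w (W w * h n (X w))%:E)%E).
  rewrite -monotone_convergence//.
  - apply: eq_integral => w _; apply/esym/cvg_lim => //.
    under eq_fun do rewrite EFinM.
    rewrite EFinM; apply: cvgeZl => //.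
    by apply: cvg_nnsfun_approx => // x _; rewrite lee_fin.
  - by move=> n; exact/measurable_EFinP.
  - by move=> n w _; rewrite lee_fin mulr_ge0.
  - move=> w _ m n mn; rewrite lee_fin ler_wpM2l//.
    exact/lefP/nd_nnsfun_approx.
congr (limn _); apply/funext => n.
under eq_integral => w _.
  rewrite fimfunE EFinM -fsumEFin// ge0_mule_fsumr; last first.
    by move=> y; rewrite nnfun_muleindic_ge0.
  over.
have mi y : measurable_fun setT
    (fun w => W w * \1_(h n @^-1` [set y]) (X w)).
  by apply: (mhX (mindic R _)); exact: measurable_sfunP.
rewrite ge0_integral_fsum//; last 2 first.
- move=> y; rewrite [X in measurable_fun _ X](_ : _ =
      (fun w => y%:E * (W w * \1_(h n @^-1` [set y]) (X w))%:E)%E).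
    by apply: measurable_funeM; exact/measurable_EFinP.
  by apply/funext => w; rewrite -!EFinM mulrCA.
- move=> y w _; apply: mule_ge0; first by rewrite lee_fin.
  by rewrite nnfun_muleindic_ge0.
(* Being a value of a nonnegative simple function, y is nonnegative and can leave the integral. *)
apply: eq_fsbigr => y; rewrite inE => -[x _ hxy].
rewrite -ge0_integralZl//.
- by apply: eq_integral => w _; rewrite -!EFinM mulrCA.
- exact/measurable_EFinP.
- by move=> w _; rewrite lee_fin mulr_ge0.
- by rewrite lee_fin -hxy.
Qed.

(** By the limit formula, agreement of two weights on indicators extends to every nonnegative
    measurable [f]. *)
Lemma ge0_eq_integralM_comp (W W' : T -> R) (f : R -> R) :
  measurable_fun setT W -> (forall w, 0 <= W w) ->
  measurable_fun setT W' -> (forall w, 0 <= W' w) ->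
  (forall A, measurable A -> (\int[mu]_w (W w * \1_A (X w))%:E =
                              \int[mu]_w (W' w * \1_A (X w))%:E)%E) ->
  measurable_fun setT f -> (forall x, 0 <= f x) ->
  (\int[mu]_w (W w * f (X w))%:E = \int[mu]_w (W' w * f (X w))%:E)%E.
Proof.
move=> mW W0 mW' W'0 WW' /measurable_EFinP mf f0.
rewrite !(ge0_integralM_comp_lim mf)//; congr (limn _); apply/funext => n.
by apply: eq_fsbigr => y _; rewrite WW'//; exact: measurable_sfunP.
Qed.

End ge0_integral_comp.

(** * Products of independent factors *)

Section independence.
Local Open Scope classical_set_scope.
Context d (T : measurableType d) (R : realType) (P : probability T R).

(** Independence is the case of indicators; factors are freed one at a time with
    [ge0_eq_integralM_comp]. *)
Lemma ge0_expectation_prod_indep k (U : 'I_k -> {RV P >-> R})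
    (f : 'I_k -> R -> R) (c : 'I_k -> R) :
  independent_RVs U ->
  (forall i, measurable_fun setT (f i)) -> (forall i x, 0 <= f i x) ->
  (forall i, (\int[P]_w (f i (U i w))%:E = (c i)%:E)%E) ->
  (\int[P]_w (\prod_(i < k) f i (U i w))%:E = (\prod_(i < k) c i)%:E)%E.
Proof.
move=> indep mf f0 fc.
(* Induction on the number [r] of factors that need not be indicators. *)
suff H r : (forall i : 'I_k, (r <= i)%N ->
      exists2 A, measurable A & f i = \1_A) ->
    (\int[P]_w (\prod_(i < k) f i (U i w))%:E = (\prod_(i < k) c i)%:E)%E.
  by apply: (H k) => i; rewrite leqNgt ltn_ord.
elim: r f c mf f0 fc => [|r IH] f c mf f0 fc find.
  (* All factors are indicators, so their product is the indicator of the intersection [B]. *)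
  have {}find i := find i (leq0n i).
  pose A i := projT1 (cid2 (find i)).
  have mA i : measurable (A i) by rewrite /A; case: cid2.
  have fA i : f i = \1_(A i) by rewrite /A; case: cid2.
  have := indep finset.setT A (fun i _ => mA i).
  set B := \bigcap_(i in _) _ => PB.
  have mB : measurable B.
    apply: fin_bigcap_measurable => // i _.
    by rewrite -[_ @^-1` _]setTI; exact: measurable_funP.
  transitivity (\int[P]_w (\1_B w)%:E)%E.
    apply: eq_integral => w _; congr (_%:E).
    under eq_bigr do rewrite fA indicE.
    rewrite indicE; case: (boolP (w \in B)) => [|] /=.
      rewrite inE => Bw; rewrite big1// => i _; rewrite mem_set//.
      by apply: (Bw i); rewrite /= finset.inE.
    move=> /negP wB; apply/eqP; rewrite prodf_seq_eq0.
    apply: contra_notT wB => /hasPn h; rewrite inE => i _ /=.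
    have := h i (mem_index_enum i); rewrite /= pnatr_eq0 eqb0 negbK.
    by rewrite inE.
  transitivity (P B); first by rewrite integral_indic// setIT.
  rewrite PB.
  rewrite (eq_bigl xpredT); last by move=> i; rewrite finset.inE.
  rewrite -prodEFin; apply: eq_bigr => i _.
  have mU : measurable (U i @^-1` A i).
    by rewrite -[_ @^-1` _]setTI; exact: measurable_funP.
  rewrite -fc fA -(setIT (U i @^-1` _)) -integral_indic//.
have [rk|kr] := ltnP r k; last first.
  apply: IH => // i ri; have := leq_trans kr ri.
  by rewrite leqNgt ltn_ord.
pose j := Ordinal rk.
rewrite (bigD1 j)//= mulrC.
have cj0 i : 0 <= c i.
  by rewrite -lee_fin -fc; apply: integral_ge0 => w _; rewrite lee_fin.
have mfU i : measurable_fun setT (fun w => f i (U i w)).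
  by apply: (measurableT_comp (mf i)); exact: measurable_funP.
rewrite EFinM -fc -ge0_integralZl//=; last 3 first.
- exact/measurable_EFinP.
- by move=> w _; rewrite lee_fin.
- by rewrite lee_fin prodr_ge0.
under eq_integral do rewrite (bigD1 j)//= mulrC.
(* Compare the weight formed by the other factors with the constant product of their means; it then
   suffices to treat an indicator in place of [f j]. *)
apply: (@ge0_eq_integralM_comp _ _ _ P (U j) _ _ (fun=> \prod_(i < k | i != j) c i) (f j)) => //.
- rewrite [X in measurable_fun _ X](_ : _ = fun w =>
    \prod_(i <- [seq i <- index_enum 'I_k | i != j]) f i (U i w)); last first.
    by apply/funext => w; rewrite big_filter.
  by apply: measurable_prod => i _; exact: mfU.
- by move=> w; rewrite prodr_ge0.
- by move=> _; rewrite prodr_ge0.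
move=> A mA.
(* With factor [j] an indicator, all factors from index r on are indicators, so the induction
   hypothesis applies to [f'] with means [c']. *)
pose f' i := if i == j then \1_A else f i.
pose c' i := if i == j then fine (P (U j @^-1` A)) else c i.
have mUA : measurable (U j @^-1` A).
  by rewrite -[_ @^-1` _]setTI; exact: measurable_funP.
have PUA : (\int[P]_w (\1_A (U j w))%:E = (fine (P (U j @^-1` A)))%:E)%E.
  rewrite fineK ?fin_num_measure// -[in RHS](setIT (U j @^-1` _)).
  by rewrite -integral_indic//.
transitivity (\int[P]_w (\prod_(i < k) f' i (U i w))%:E)%E.
  apply: eq_integral => w _; rewrite [in RHS](bigD1 j)//= mulrC /f' eqxx.
  by congr (_ * _)%:E; apply: eq_bigr => i /negbTE ->.
rewrite (IH f' c').
- under [RHS]eq_integral do rewrite EFinM.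
  rewrite ge0_integralZl//=; last 2 first.
  + apply/measurable_EFinP.
    have mi : measurable_fun [set: R] (\1_A : R -> R) by exact: measurable_indic.
    by apply: (measurableT_comp mi); exact: measurable_funP.
  + by rewrite lee_fin prodr_ge0.
  rewrite PUA -EFinM (bigD1 j)//= mulrC /c' eqxx.
  by congr (_ * _)%:E; apply: eq_bigr => i /negbTE ->.
- by move=> i; rewrite /f'; case: eqP => // _; exact: measurable_indic.
- by move=> i x; rewrite /f'; case: eqP.
- by move=> i; rewrite /f' /c'; case: eqP => [->|].
- move=> i ri; rewrite /f'; case: eqP => [_|/eqP ij]; first by exists A.
  apply: find; rewrite ltn_neqAle ri andbT.
  by apply: contra_neq ij => rj; exact: val_inj.
Qed.

End independence.

(** * Moments of sums of independent uniform variables *)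

Section uniform_moments.
Local Open Scope classical_set_scope.
Context d (T : measurableType d) (R : realType) (P : probability T R).
Local Notation pos x := (Num.max x 0).

Lemma integral_exprn_01 (a : nat) :
  (\int[@lebesgue_measure R]_(x in `[0%R, 1%R]) (x ^+ a)%:E = (a.+1%:R^-1)%:E)%E.
Proof.
pose F (x : R) : R := a.+1%:R^-1 * x ^+ a.+1.
have dF (x : R) : is_derive x 1 F (x ^+ a).
  rewrite (_ : F = a.+1%:R^-1 \*: (id ^+ a.+1)); last first.
    by apply/funext => y; rewrite /= exprfctE.
  apply: is_derive_eq.
  by rewrite /GRing.scale /= mulr1 mulKf ?pnatr_eq0.
have cF (x : R) : {for x, continuous F}.
  by apply/differentiable_continuous/derivable1_diffP; exact: ex_derive.
rewrite (@continuous_FTC2 _ _ F) //.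
- by rewrite /F expr1n expr0n /= mulr0 mulr1 sube0.
- by apply: continuous_subspaceT => x; exact: exprn_continuous.
- split.
  + by move=> x _; apply: ex_derive.
  + by apply: cvg_at_right_filter; exact: cF.
  + by apply: cvg_at_left_filter; exact: cF.
- by move=> x _; rewrite derive1E derive_val.
Qed.

Lemma measurable_pos_expr a : measurable_fun [set: R] (fun x : R => pos x ^+ a).
Proof. by apply: measurable_funX; exact: measurable_maxr. Qed.

(** The integral is carried over to the uniform law, whose support [0, 1] is where the positive part
    is the identity. *)
Lemma uniform01_moment (X : {RV P >-> R}) (a : nat) : uniform01 X ->
  (\int[P]_w (pos (X w) ^+ a)%:E = (a.+1%:R^-1)%:E)%E.
Proof.
move=> unifX; have /measurable_EFinP mf := measurable_pos_expr a.
have p0 (x : R) : 0 <= pos x ^+ a by rewrite exprn_ge0// le_max lexx orbT.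
have mX : measurable_fun setT (X : T -> measurableTypeR R).
  exact: (measurable_funP X).
pose mX_mixin := isMeasurableFun.Build _ _ _ _ _ mX.
pose X' : {mfun T >-> measurableTypeR R} := HB.pack (X : T -> measurableTypeR R) mX_mixin.
transitivity (\int[distribution P X']_x (pos x ^+ a)%:E)%E.
  by rewrite ge0_integral_distribution// => x; rewrite lee_fin.
transitivity (\int[uniform_prob (@ltr01 R)]_x (pos x ^+ a)%:E)%E.
  by apply: eq_measure_integral => A mA _; exact: unifX.
rewrite integral_uniform//.
rewrite subr0 invr1 mul1e -integral_exprn_01.
apply: eq_integral => x; rewrite inE/= in_itv/= => /andP[x0 _].
by rewrite max_l.
Qed.

(** The negative half-line misses [0, 1], hence has uniform measure 0. *)
Lemma uniform01_ae_ge0 (X : {RV P >-> R}) : uniform01 X ->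
  {ae P, forall w, 0 <= X w}.
Proof.
move=> unifX; exists (X @^-1` `]-oo, 0[); split.
- by rewrite -[_ @^-1` _]setTI; exact: measurable_funP.
- have -> : P (X @^-1` `]-oo, 0[) = distribution P X `]-oo, 0[ by [].
  rewrite unifX// /uniform_prob integral_uniform_pdf.
  rewrite (_ : _ `&` _ = set0) ?integral_set0//.
  apply/seteqP; split => x //= []; rewrite !in_itv/= => x0 /andP[].
  by rewrite leNgt x0.
- by move=> w /= /negP; rewrite -ltNge in_itv.
Qed.

(* Replacing [U i] by its positive part, equal to it almost everywhere, makes
   all integrands nonnegative, so that no integrability side condition arises.
   The binomial theorem applied to the [r]-th summand produces powers of
   [U r], which the free exponents [a] absorb in the induction. *)
Lemma moment_partial_sum k (U : 'I_k -> {RV P >-> R}) r m (a : 'I_k -> nat) :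
  independent_RVs U -> (forall i, uniform01 (U i)) -> (r <= k)%N ->
  (\int[P]_w ((\sum_(i < k | (i < r)%N) pos (U i w)) ^+ m *
              \prod_(i < k | (r <= i)%N) pos (U i w) ^+ a i)%:E =
   (m`!%:R * fps_pow (@fps_expm1_div_t R) r m *
    \prod_(i < k | (r <= i)%N) (a i).+1%:R^-1)%:E)%E.
Proof.
move=> indep unif.
have V0 i w : 0 <= pos (U i w) by rewrite le_max lexx orbT.
elim: r m a => [|r IH] m a rk.
  (* The empty sum gives 0^m, which matches the coefficients of the series 1; independence handles
     the product. *)
  under eq_integral do rewrite big_pred0_eq EFinM.
  rewrite ge0_integralZl//=; last 2 first.
  - apply/measurable_EFinP; apply: measurable_prod => i _.
    by apply: (measurableT_comp (measurable_pos_expr _)); exact: measurable_funP.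
  - by move=> w _; rewrite lee_fin prodr_ge0// => i _; rewrite exprn_ge0.
  rewrite (ge0_expectation_prod_indep (f := fun i x => pos x ^+ a i)
    (c := fun i => (a i).+1%:R^-1))//=; last 3 first.
  - by move=> i; exact: measurable_pos_expr.
  - by move=> i x; rewrite exprn_ge0// le_max lexx orbT.
  - by move=> i; exact: uniform01_moment.
  by rewrite -EFinM expr0n /fps_one; case: m => [|m]; rewrite ?mul1r// mulr0.
pose j := Ordinal rk.
have mS w : \sum_(i < k | (i < r.+1)%N) pos (U i w) =
    \sum_(i < k | (i < r)%N) pos (U i w) + pos (U j w).
  rewrite (bigD1 j)//= addrC; congr (_ + _); apply: eq_bigl => i.
  by rewrite ltnS -val_eqE /= [RHS]ltn_neqAle andbC.
have prodj (F : 'I_k -> R) : \prod_(i < k | (r <= i)%N) F i =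
    F j * \prod_(i < k | (r < i)%N) F i.
  rewrite (bigD1 j)//=; congr (_ * _); apply: eq_bigl => i.
  by rewrite -val_eqE /= [RHS]ltn_neqAle andbC eq_sym.
(* At stage r+1 only exponents at indices above r occur, so the one at [j] is free to take the
   binomial exponent q. *)
pose b q i := if i == j then q else a i.
have bj q (F : 'I_k -> nat -> R) : \prod_(i < k | (r <= i)%N) F i (b q i) =
    F j q * \prod_(i < k | (r < i)%N) F i (a i).
  rewrite prodj /b eqxx; congr (_ * _); apply: eq_bigr => i ri.
  by rewrite ifN// -val_eqE /= gtn_eqF.
pose G q w := (\sum_(i < k | (i < r)%N) pos (U i w)) ^+ (m - q) *
  \prod_(i < k | (r <= i)%N) pos (U i w) ^+ b q i.
have mV i n : measurable_fun setT (fun w => pos (U i w) ^+ n).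
  by apply: (measurableT_comp (measurable_pos_expr _)); exact: measurable_funP.
have mG q : measurable_fun setT (G q).
  apply: measurable_funM.
    apply: measurable_funX.
    under eq_fun do rewrite -big_filter.
    by apply: measurable_sum => i; exact: (mV i 1%N).
  under eq_fun do rewrite -big_filter.
  by apply: measurable_prod => i _; exact: mV.
have G0 q w : 0 <= G q w.
  rewrite mulr_ge0// ?exprn_ge0 ?sumr_ge0// prodr_ge0// => i _.
  by rewrite exprn_ge0.
transitivity (\int[P]_w (\sum_(q < m.+1) ('C(m, q)%:R)%:E * (G q w)%:E))%E.
  apply: eq_integral => w _; rewrite sumEFin; congr (_%:E).
  rewrite mS exprDn mulr_suml; apply: eq_bigr => q _.
  by rewrite /G (bj q (fun i n => pos (U i w) ^+ n)) -mulr_natl; ring.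
rewrite ge0_integral_sum//; last 2 first.
- by move=> q; apply: measurable_funeM; exact/measurable_EFinP.
- by move=> q w _; rewrite -EFinM lee_fin mulr_ge0.
(* Terms of phi^(r+1) = phi phi^r match the binomial ones, as C(m,q) (m-q)! / (q+1) = m! /
   (q+1)!. *)
rewrite [fps_pow _ r.+1]/(fps_mul _ (fps_pow _ r)) /fps_mul.
rewrite mulr_sumr mulr_suml -sumEFin; apply: eq_bigr => q _.
rewrite ge0_integralZl//=; last 2 first.
- exact/measurable_EFinP.
- by move=> w _; rewrite lee_fin.
rewrite /G IH; last exact: ltnW.
rewrite -EFinM (bj q (fun i n => n.+1%:R^-1)); congr (_%:E).
have qm : (q <= m)%N by rewrite -ltnS.
rewrite /fps_expm1_div_t -[in RHS](bin_fact qm) factS !natrM.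
have f0 n : n`!%:R != 0 :> R by rewrite pnatr_eq0 -lt0n fact_gt0.
by field; rewrite f0 nat1r pnatr_eq0.
Qed.

(** Case r = k of [moment_partial_sum], where no free exponents remain; almost everywhere each [U i]
    equals its positive part. *)
Lemma expectation_sum_uniform01 k (U : 'I_k -> {RV P >-> R}) m :
  independent_RVs U -> (forall i, uniform01 (U i)) ->
  ('E_P[fun w : T => ((\sum_(i < k) U i w) ^+ m)%R] =
   (m`!%:R * fps_pow (@fps_expm1_div_t R) k m)%:E)%E.
Proof.
move=> indep unif.
rewrite unlock; have := moment_partial_sum m (fun=> 0%N) indep unif (leqnn k).
have lek (i : 'I_k) : (k <= i)%N = false by rewrite leqNgt ltn_ord.
rewrite [X in (_ * X)%:E](big_pred0 _ _ _ _ lek) mulr1 => <-.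
have mU i : measurable_fun setT (U i) := measurable_funP (U i).
have mV i : measurable_fun setT (fun w => pos (U i w)).
  exact: measurable_maxr.
have ltk : (fun i : 'I_k => (i < k)%N) =1 xpredT by move=> i; exact: ltn_ord.
under [RHS]eq_integral.
  move=> w _; rewrite (big_pred0 _ _ _ _ lek) mulr1.
  rewrite (eq_bigl _ _ ltk); over.
apply: ae_eq_integral => //.
- by apply/measurable_EFinP/measurable_funX; exact: measurable_sum.
- by apply/measurable_EFinP/measurable_funX; exact: measurable_sum.
have ae0 : \forall w \near almost_everywhere P, forall i, 0 <= U i w.
  by apply: filter_forall => i; exact: uniform01_ae_ge0.
apply: filterS ae0 => w U0 _; congr ((_ ^+ _)%:E); apply: eq_bigr => i _.
by rewrite max_l.
Qed.

End uniform_moments.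

Theorem theorem1 (R : realType) (d : measure_display) (T : measurableType d)
    (P : probability T R) (k n : nat) (U : 'I_k -> {RV P >-> R})
    (hindep : independent_RVs U) (hunif : forall i : 'I_k, uniform01 (U i)) :
  (\sum_(m < n.+1) \sum_(k <= l < (m + k).+1)
      ('C(n, m))%:R / ('C(m + k, m))%:R
      * stirling2 R l k * stirling2 R (m + k) l
      * bernoulli_order R k (n - m))%:E
  = (\sum_(m < n.+1) (stirling2 R n m)%:E
      * 'E_P[fun w : T => ((\sum_(i < k) U i w) ^+ m)%R])%E.
Proof.
rewrite sum_stirling2_bernoulli -sumEFin; apply: eq_bigr => m _.
by rewrite expectation_sum_uniform01.
Qed.
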